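(* We have $$\sum_{\pi\in\overline{\mathfrak{OE}}}z^{\mathrm{srank}(\pi)}q^{|\pi|}=\sum_{m=1}^{\infty}\sum_{n=1}^{\infty}\frac{q^{4mn-1}}{(z^2q^2;q^4)_{m}\,(q^2/z^2;q^4)_{n}}.$$
   Context: A partition is a finite weakly decreasing sequence of positive integers (its parts), and $|\pi|$ is the sum of the parts of $\pi$. The conjugate $\pi'$ is obtained by transposing the Ferrers graph of $\pi$. $\mathcal{O}(\pi)$ denotes the number of odd parts of $\pi$, counted with multiplicity, and the Stanley rank is $\mathrm{srank}(\pi)=\mathcal{O}(\pi)-\mathcal{O}(\pi')$. $\overline{\mathfrak{OE}}$ is the set of partitions in which each odd part is less than each even part, both even and odd parts appear, and only the largest odd part and the largest even part appear an odd number of times (that is, these two part sizes have odd multiplicity and every other part size that occurs has even multiplicity). Notation: $(a;q)_n=\prod_{j=0}^{n-1}(1-aq^j)$. The identity may be read as one of formal power series in $q$ whose coefficients are Laurent polynomials in $z$. *)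

(* Defs.v *)
From HB Require Import structures.
From mathcomp Require Import all_boot all_order all_algebra.
From mathcomp Require Import fraction.
From mathcomp Require Import boolp classical_sets functions cardinality fsbigop.

Set Implicit Arguments.
Unset Strict Implicit.
Unset Printing Implicit Defensive.

Import GRing.Theory.

Local Open Scope ring_scope.
Local Open Scope classical_set_scope.

Local Notation "x %:F" := (@tofrac _ x).

Definition is_intpart (s : seq nat) : bool :=
  sorted geq s && all (fun x => 0 < x)%N s.

Record intpart := IntPart { parts :> seq nat; _ : is_intpart parts }.

HB.instance Definition _ := [isSub for parts].
HB.instance Definition _ := [Choice of intpart by <:].

(* The length of column i of the Ferrers graph is the number of rows of length
   greater than i, and there are as many columns as the largest part. *)
Definition conjugate_seq (s : seq nat) : seq nat :=
  [seq count (fun x => i < x)%N s | i <- iota 0 (head 0%N s)].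

Lemma conjugate_subproof (p : intpart) : is_intpart (conjugate_seq p).
Proof.
case: p => s /= /andP[_ _]; apply/andP; split; last first.
  apply/allP => x /mapP[i]; rewrite mem_iota add0n => /andP[_ Hi] ->.
  by case: s Hi => [|a s] //= ->.
apply: (homo_sorted (e := leq)); last exact: iota_sorted.
by move=> i j ij /=; apply: sub_count => x; apply: leq_ltn_trans.
Qed.

Definition conjugate (p : intpart) : intpart := IntPart (conjugate_subproof p).

(* The cells (i, j) of the Ferrers graph of p are those with j < nth 0 p i. *)
Lemma conjugateE (p : intpart) (i j : nat) :
  (j < nth 0 (conjugate p) i)%N = (i < nth 0 p j)%N.
Proof.
case: p => s /= /andP[Hs _].
have -> : nth 0%N (conjugate_seq s) i = count (fun x => i < x)%N s.
  case: (ltnP i (head 0%N s)) => Hi.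
    by rewrite (nth_map 0%N) ?size_iota // nth_iota.
  rewrite nth_default ?size_map ?size_iota //; apply/esym/eqP.
  rewrite -leqn0 leqNgt -has_count; apply/hasPn => x xs; rewrite -leqNgt.
  apply: leq_trans Hi; case: s Hs xs => [|a s] //= Hs.
  rewrite inE => /orP[/eqP->//|xs].
  have tr : transitive geq by move=> u v w /= h1 h2; apply: leq_trans h2 h1.
  exact: (allP (order_path_min tr Hs)).
elim: s Hs j => [|a s IH] /= Hs j; first by rewrite nth_nil.
have tr : transitive geq by move=> u v w /= h1 h2; apply: leq_trans h2 h1.
case: (ltnP i a) => Hi.
  by case: j => [|j] /=; rewrite ?Hi // -IH ?(path_sorted Hs).
have -> : count (fun x => i < x)%N s = 0%N.
  apply/eqP; rewrite -leqn0 leqNgt -has_count; apply/hasPn => x xs.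
  rewrite -leqNgt; apply: leq_trans Hi.
  exact: (allP (order_path_min tr Hs)).
rewrite ltn0; apply/esym/negbTE; rewrite -leqNgt.
case: j => [|j] //=; apply: leq_trans Hi.
have [js|js] := ltnP j (size s); last by rewrite nth_default.
by apply: (allP (order_path_min tr Hs)); apply: mem_nth.
Qed.

Definition weight (p : intpart) : nat := sumn p.

Definition nb_odd (p : intpart) : nat := count odd p.

Definition srank (p : intpart) : int :=
  (nb_odd p)%:Z - (nb_odd (conjugate p))%:Z.

(* Both are 0 when there is no odd, resp. even, part. *)
Definition max_odd (p : intpart) : nat := \max_(x <- p | odd x) x.
Definition max_even (p : intpart) : nat := \max_(x <- p | ~~ odd x) x.

Definition OEbar : set intpart := [set p : intpart |
  [/\ forall a b : nat, a \in parts p -> b \in parts p ->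
        odd a -> ~~ odd b -> (a < b)%N,
      has odd p,
      has (predC odd) p &
      forall x : nat, x \in parts p ->
        odd (count_mem x p) <-> x = max_odd p \/ x = max_even p]].

Definition fracX : {fraction {poly int}} := ('X : {poly int})%:F.

(* Z[z, 1/z] is the subring of Z(z) of the elements x such that x * z ^ n is
   a polynomial in z for some natural number n. *)
Definition laurent_pred : {pred {fraction {poly int}}} :=
  fun x => `[< exists (n : nat) (p : {poly int}), x * fracX ^+ n = p%:F >].

Lemma laurent_subring : subring_closed laurent_pred.
Proof.
split.
- by apply/asboolP; exists 0%N, 1; rewrite rmorph1 mulr1.
- move=> x y /asboolP[m [p Hp]] /asboolP[n [r Hr]]; apply/asboolP.
  exists (m + n)%N, (p * 'X ^+ n - r * 'X ^+ m).
  rewrite rmorphB !rmorphM !rmorphXn /= -Hp -Hr exprD mulrBl !mulrA.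
  by congr (_ - _); rewrite mulrAC.
- move=> x y /asboolP[m [p Hp]] /asboolP[n [r Hr]]; apply/asboolP.
  exists (m + n)%N, (p * r); rewrite rmorphM /= -Hp -Hr exprD.
  by rewrite mulrACA.
Qed.

HB.instance Definition _ :=
  GRing.isSubringClosed.Build _ laurent_pred laurent_subring.

Record laurent := Laurent
  { laurent_val : {fraction {poly int}}; _ : laurent_val \in laurent_pred }.

HB.instance Definition _ := [isSub for laurent_val].
HB.instance Definition _ := [Choice of laurent by <:].
HB.instance Definition _ := [SubChoice_isSubComNzRing of laurent by <:].

Lemma lz_subproof : fracX \in laurent_pred.
Proof. by apply/asboolP; exists 0%N, 'X; rewrite mulr1. Qed.

Definition lz : laurent := Laurent lz_subproof.

(* A record rather than [nat -> R], on which the library has the pointwise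
   ring structure. *)
Record fps (R : Type) := Fps { fcoef : nat -> R }.

Lemma fpsP (R : Type) (a b : fps R) : fcoef a =1 fcoef b -> a = b.
Proof. by case: a b => [a] [b] /= /funext ->. Qed.

HB.instance Definition _ (R : Type) := gen_eqMixin (fps R).
HB.instance Definition _ (R : Type) := gen_choiceMixin (fps R).

Section FpsRing.
Variable R : comNzRingType.
Implicit Types a b c : fps R.

Definition fps_zero : fps R := Fps (fun=> 0).
Definition fps_opp a : fps R := Fps (fun n => - fcoef a n).
Definition fps_add a b : fps R := Fps (fun n => fcoef a n + fcoef b n).
Definition fps_const (r : R) : fps R := Fps (fun n => if n is 0 then r else 0).
Definition fps_mul a b : fps R :=
  Fps (fun n => \sum_(i < n.+1) fcoef a i * fcoef b (n - i)).
Definition fps_X : fps R := Fps (fun n => (n == 1%N)%:R).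

Lemma fps_addA : associative fps_add.
Proof. by move=> a b c; apply: fpsP => n /=; rewrite addrA. Qed.
Lemma fps_addC : commutative fps_add.
Proof. by move=> a b; apply: fpsP => n /=; rewrite addrC. Qed.
Lemma fps_add0 : left_id fps_zero fps_add.
Proof. by move=> a; apply: fpsP => n /=; rewrite add0r. Qed.
Lemma fps_addN : left_inverse fps_zero fps_opp fps_add.
Proof. by move=> a; apply: fpsP => n /=; rewrite addNr. Qed.

HB.instance Definition _ :=
  GRing.isZmodule.Build (fps R) fps_addA fps_addC fps_add0 fps_addN.

Let trunc N a : {poly R} := \poly_(i < N.+1) fcoef a i.

Let trunc_mul N n a b (p r : {poly R}) : (n <= N)%N ->
    (forall i, (i <= N)%N -> p`_i = fcoef a i) ->
    (forall i, (i <= N)%N -> r`_i = fcoef b i) ->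
  (p * r)`_n = fcoef (fps_mul a b) n.
Proof.
move=> nN Hp Hr; rewrite coefM /=; apply: eq_bigr => i _.
rewrite Hp ?Hr //; first by apply: leq_trans nN; apply: leq_subr.
by apply: leq_trans nN; rewrite -ltnS.
Qed.

Let truncE N a i : (i <= N)%N -> (trunc N a)`_i = fcoef a i.
Proof. by move=> iN; rewrite coef_poly ltnS iN. Qed.

Lemma fps_mulA : associative fps_mul.
Proof.
move=> a b c; apply: fpsP => n.
rewrite -(@trunc_mul n n a _ (trunc n a) (trunc n b * trunc n c)) //.
- rewrite mulrA (@trunc_mul n n (fps_mul a b) c) // => i iN.
  - by apply: (@trunc_mul n) => // *; apply: truncE.
  - exact: truncE.
- by move=> *; apply: truncE.
- by move=> i iN; apply: (@trunc_mul n) => // *; apply: truncE.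
Qed.

Lemma fps_mulC : commutative fps_mul.
Proof.
move=> a b; apply: fpsP => n.
rewrite -(@trunc_mul n n a b (trunc n a) (trunc n b)) //; last 2 first.
- by move=> *; apply: truncE.
- by move=> *; apply: truncE.
by rewrite mulrC; apply: (@trunc_mul n) => // *; apply: truncE.
Qed.

Lemma fps_mul1 : left_id (fps_const 1) fps_mul.
Proof.
move=> a; apply: fpsP => n /=.
rewrite big_ord_recl /= mul1r subn0 big1 ?addr0 // => i _.
by rewrite mul0r.
Qed.

Lemma fps_mulDl : left_distributive fps_mul fps_add.
Proof.
move=> a b c; apply: fpsP => n /=; rewrite -big_split /=.
by apply: eq_bigr => i _; rewrite mulrDl.
Qed.

Lemma fps_one_neq0 : fps_const 1 != 0 :> fps R.
Proof.
apply/eqP => /(congr1 (fun a => fcoef a 0)) /= /eqP.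
by rewrite oner_eq0.
Qed.

HB.instance Definition _ := GRing.Zmodule_isComNzRing.Build (fps R)
  fps_mulA fps_mulC fps_mul1 fps_mulDl fps_one_neq0.

Definition fps_unit : {pred fps R} := fun a => `[< exists b, b * a = 1 >].

Definition fps_inv a : fps R :=
  if pselect (exists b, b * a = 1) is left e then projT1 (cid e) else a.

Lemma fps_mulVx : {in fps_unit, left_inverse 1 fps_inv *%R}.
Proof.
move=> a /asboolP Ha; rewrite /fps_inv.
by case: pselect => // e; case: (cid e).
Qed.
Lemma fps_unitPl a b : b * a = 1 -> fps_unit a.
Proof. by move=> ab; apply/asboolP; exists b. Qed.
Lemma fps_invr_out : {in [predC fps_unit], fps_inv =1 id}.
Proof. by move=> a /asboolPn Ha; rewrite /fps_inv; case: pselect. Qed.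

HB.instance Definition _ := GRing.ComNzRing_hasMulInverse.Build (fps R)
  fps_mulVx fps_unitPl fps_invr_out.

Lemma fps_unit_coef0 a : fcoef a 0 = 1 -> a \is a GRing.unit.
Proof.
move=> a0.
pose step (s : seq R) := rcons s ((size s == 0)%:R -
  \sum_(i < size s) s`_i * fcoef a (size s - i)).
pose s n := iter n step [::].
have szs n : size (s n) = n by elim: n => //= n IH; rewrite size_rcons IH.
have nths m n i : (i < n)%N -> (s (n + m)%N)`_i = (s n)`_i.
  move=> Hi; elim: m => [|m IH]; rewrite ?addn0 // addnS /= -/(s _).
  by rewrite nth_rcons szs ltn_addr.
apply/asboolP; exists (Fps (fun n => (s n.+1)`_n)); apply: fpsP => n /=.
rewrite big_ord_recr /= subnn a0 mulr1 nth_rcons -/(s n) szs ltnn eqxx.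
rewrite (eq_bigr (fun i : 'I_n => (s n)`_i * fcoef a (n - i))); last first.
  by move=> i _; rewrite -(nths (n - i.+1)%N i.+1 i) // subnKC.
by rewrite addrC subrK; case: n.
Qed.

(* The family F, indexed by A, is summable when each power of the variable
   occurs in finitely many of its members; fps_sum takes the finite sums of
   coefficients.  The finitely supported sum \sum_(i \in A) is 0 by convention
   on infinite supports, so fps_sum is meaningful for summable families. *)
Definition fps_summable (I : choiceType) (A : set I) (F : I -> fps R) : Prop :=
  forall n : nat, finite_set (A `&` [set i | fcoef (F i) n != 0]).

Definition fps_sum (I : choiceType) (A : set I) (F : I -> fps R) : fps R :=
  Fps (fun n => \sum_(i \in A) fcoef (F i) n).

End FpsRing.

Definition qpoch (S : pzRingType) (a q : S) (n : nat) : S :=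
  \prod_(j < n) (1 - a * q ^+ j).

Definition z : fps laurent := fps_const lz.
Definition q : fps laurent := fps_X laurent.

(* Negative powers z ^ k, k : int, are thus genuine inverses; division by a
   series with constant coefficient 1 is covered by fps_unit_coef0. *)
Lemma z_unit : z \is a GRing.unit.
Proof.
have Hi : fracX^-1 \in laurent_pred.
  apply/asboolP; exists 1%N, 1; rewrite expr1 mulVf ?rmorph1 //.
  by rewrite /fracX tofrac_eq0 polyX_eq0.
apply/unitrPr; exists (fps_const (Laurent Hi)).
apply: fpsP => n /=; rewrite /z /=; case: n => [|n] /=.
  rewrite big_ord_recl big_ord0 addr0 /=; apply: val_inj => /=.
  by rewrite mulfV // /fracX tofrac_eq0 polyX_eq0.
rewrite big_ord_recl /= mulr0 add0r big1 // => i _.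
by rewrite mul0r.
Qed.

(* Main.v *)
(* A partition in OEbar with largest odd part 2a - 1 and largest even part 2b
   consists of one copy of each of these two parts and of pairs of equal parts
   with sizes among 1, 3, .., 2a - 1, 2a, 2a + 2, .., 2b.  Inserting a pair
   leaves the parities of the columns unchanged, so a pair of odd parts 2j - 1
   contributes z^2 q^(4j - 2), a pair of even parts 2k contributes q^(4k), and
   the bare partition (2b, 2a - 1) contributes z^(2a - 2b) q^(2a + 2b - 1).
   With Q = q^4 and x = q^2 / z^2, the left-hand side is therefore
     sum_(a >= 1) q^(4a - 1) / (z^2 q^2; Q)_a
       * sum_(c >= 0) x^c / (Q^a; Q)_(c + 1),
   and the inner sum equals sum_(n >= 0) Q^(a n) / (x; Q)_(n + 1). *)
Require Import Defs.
From mathcomp Require Import all_boot all_order all_algebra.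
From mathcomp Require Import boolp classical_sets functions cardinality fsbigop.
From mathcomp Require Import zify ring.

Set Implicit Arguments.
Unset Strict Implicit.
Unset Printing Implicit Defensive.

Import GRing.Theory.

(** * Maxima and finiteness for sequences of natural numbers *)

Section MaxSeq.
Implicit Types (s : seq nat) (P : pred nat).

Lemma bigmax_seq_mem s P : has P s ->
  P (\max_(x <- s | P x) x) /\ \max_(x <- s | P x) x \in s.
Proof.
rewrite has_filter -big_filter => sP.
suff : \max_(x <- filter P s) x \in filter P s.
  by rewrite mem_filter => /andP[].
elim: (filter P s) sP => // x t IH _; rewrite big_cons.
case: t IH => [|y t] IH; first by rewrite big_nil maxn0 mem_head.
by rewrite /maxn; case: ifP => _; rewrite inE ?eqxx // IH ?orbT.
Qed.

Lemma bigmax_seq_eq s P x : x \in s -> P x ->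
  (forall y, y \in s -> P y -> y <= x) -> \max_(y <- s | P y) y = x.
Proof.
move=> xs Px ub; apply/eqP; rewrite eqn_leq; apply/andP; split.
  by apply/bigmax_leqP_seq.
exact: (leq_bigmax_seq (F := id)).
Qed.

End MaxSeq.

Lemma leq_sumn (s : seq nat) : all (leq^~ (sumn s)) s.
Proof.
elim: s => //= x s IH; rewrite leq_addr /=.
by apply: sub_all IH => y /leq_trans -> //; apply: leq_addl.
Qed.

Section FiniteSeqs.
Local Open Scope classical_set_scope.

(** Serves the summability of both families indexed by sequences: partitions, and lists of half
    multiplicities. *)
Lemma finite_bounded_seqs (k n : nat) :
  finite_set [set s : seq nat | size s <= k /\ all (leq^~ n) s].
Proof.
elim: k => [|k IH].
  apply: (sub_finite_set _ (finite_set1 [::])) => s [].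
  by rewrite leqn0 => /nilP ->.
have fin := finite_image2 cons (finite_II n.+1) IH.
have {fin} : finite_set ([set [::]] `|` [set x :: s | x in `I_n.+1 & s in
    [set s : seq nat | size s <= k /\ all (leq^~ n) s]]).
  by rewrite finite_setU; split=> //; exact: finite_set1.
apply: sub_finite_set.
case=> [|x s] [/= sk]; first by left.
by case/andP=> xn sn; right; exists x => //; exists s.
Qed.

End FiniteSeqs.

(** * Integer partitions: conjugation and bounded weight *)

Section IntPartitions.
Implicit Types p : intpart.

Lemma geq_trans : transitive geq.
Proof. by move=> y x w /= xy yw; apply: leq_trans xy. Qed.

Lemma intpart_sorted p : sorted geq p.
Proof. by case: p => s /= /andP[]. Qed.

Lemma intpart_pos p x : x \in parts p -> 0 < x.
Proof. by case: p => s /= /andP[_ /allP]; apply. Qed.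

Lemma intpart_le_head p x : x \in parts p -> x <= head 0 p.
Proof.
have := intpart_sorted p; case: (parts p) => //= y s ys.
rewrite inE => /orP[/eqP->//|]; exact: (allP (order_path_min geq_trans ys)).
Qed.

(** Columns beyond the largest part have length 0, which is even, so any upper bound [B] on the
    parts can serve as the number of columns inspected. *)
Lemma nb_odd_conjugate p B : all (leq^~ B) p ->
  nb_odd (conjugate p) =
  count (fun j => odd (count (fun x => j < x) p)) (iota 0 B).
Proof.
move=> pB; rewrite /nb_odd /= /conjugate_seq count_map.
set k := head _ _; have kB : k <= B.
  by rewrite /k; case: (parts p) pB => //= x s /andP[].
rewrite -(subnKC kB) iotaD count_cat add0n.
rewrite (@eq_in_count _ _ pred0 (iota k _)) ?count_pred0 ?addn0 // => j.
rewrite mem_iota => /andP[kj _] /=.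
rewrite (@eq_in_count _ _ pred0) ?count_pred0 // => x /intpart_le_head xk /=.
by rewrite ltnNge (leq_trans xk).
Qed.

(** Positive parts with sum at most [n] are at most [n] both in number and in size. *)
Lemma finite_weight_le n :
  finite_set [set p : intpart | weight p <= n]%classic.
Proof.
apply: sub_finite_set (finite_preimage (f := parts) _
  (finite_bounded_seqs n n)); last by move=> p p' _ _; apply: val_inj.
move=> p /= pn; split; last first.
  by apply: sub_all (leq_sumn p) => x /leq_trans; apply.
apply: leq_trans pn.
have := @intpart_pos p; rewrite /weight; elim: (parts p) => //= x s IH pos.
have x0 := pos x (mem_head _ _).
have := IH (fun y ys => pos y (mem_behead (s := x :: s) ys)).
by lia.
Qed.

End IntPartitions.

(** * Partitions in [OEbar] built from half multiplicities *)

Section Encoding.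

(* The odd sizes 1, 3, .., 2a - 1 followed by the even sizes 2a, 2a + 2, .. *)
Definition part_size (a i : nat) : nat := 2 * i + (i < a).

Lemma part_size_inj a : injective (part_size a).
Proof. by move=> i j; rewrite /part_size; lia. Qed.

Lemma odd_part_size a i : odd (part_size a i) = (i < a).
Proof. by rewrite /part_size; lia. Qed.

(* Removing one copy of the largest odd part and one copy of the largest even
   part leaves every multiplicity even; [h] lists the half multiplicities. *)
Definition mult (a : nat) (h : seq nat) (i : nat) : nat :=
  2 * nth 0 h i + (i == a.-1) + (i == (size h).-1).

Definition encode_seq (a : nat) (h : seq nat) : seq nat :=
  sort geq (flatten [seq nseq (mult a h i) (part_size a i)
                    | i <- iota 0 (size h)]).

Variables (a : nat) (h : seq nat).
Hypotheses (a0 : 0 < a) (ah : a < size h).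

Let b := (size h).-1.

(** An additive statistic splits into the doubled contribution of the pairs and that of the two
    unpaired parts. Weight, number of odd parts and column lengths are the instances used below. *)
Lemma sum_mult (F : nat -> nat) :
  \sum_(i < size h) mult a h i * F i =
  2 * (\sum_(i < size h) nth 0 h i * F i) + F a.-1 + F b.
Proof.
have single k : k < size h -> \sum_(i < size h) (i == k :> nat) * F i = F k.
  move=> kh; rewrite (bigD1 (Ordinal kh)) //= eqxx mul1n big1 ?addn0 // => i.
  by rewrite -val_eqE /= => /negbTE ->.
rewrite -[F a.-1]single; last by lia.
rewrite -[F b]single; last by rewrite /b; lia.
rewrite big_distrr -!big_split /=; apply: eq_bigr => i _.
by rewrite /mult -/b; lia.
Qed.

Lemma count_encode (P : pred nat) :
  count P (encode_seq a h) = \sum_(i < size h) mult a h i * P (part_size a i).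
Proof.
rewrite count_sort count_flatten sumnE !big_map.
rewrite -(big_mkord xpredT (fun i => mult a h i * P (part_size a i))) /index_iota subn0.
by apply: eq_bigr => i _; rewrite count_nseq mulnC.
Qed.

Lemma sumn_encode :
  sumn (encode_seq a h) = \sum_(i < size h) mult a h i * part_size a i.
Proof.
rewrite sumnE (perm_big _ (permEl (perm_sort _ _))) /= -sumnE sumn_flatten.
rewrite sumnE !big_map.
rewrite -(big_mkord xpredT (fun i => mult a h i * part_size a i)) /index_iota subn0.
by apply: eq_bigr => i _; rewrite sumn_nseq mulnC.
Qed.

Lemma count_mem_encode i : i < size h ->
  count_mem (part_size a i) (encode_seq a h) = mult a h i.
Proof.
move=> ih; rewrite count_encode (bigD1 (Ordinal ih)) //= eqxx muln1.
rewrite big1 ?addn0 // => j; rewrite -val_eqE /= => ji.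
by rewrite (inj_eq (@part_size_inj a)) (negbTE ji) muln0.
Qed.

Lemma mem_encodeP x :
  reflect (exists i, [/\ i < size h, x = part_size a i & 0 < mult a h i])
          (x \in encode_seq a h).
Proof.
apply: (iffP idP) => [|[i [ih -> i0]]]; last first.
  by rewrite -has_pred1 has_count count_mem_encode.
rewrite -has_pred1 has_count count_encode lt0n sum_nat_eq0 negb_forall.
case/existsP => i /=; rewrite muln_eq0 negb_or eqb0 negbK.
by case/andP=> i0 /eqP <-; exists i; rewrite lt0n.
Qed.

Lemma max_odd_mem_encode : part_size a a.-1 \in encode_seq a h.
Proof.
apply/mem_encodeP; exists a.-1; split=> //; first by lia.
by rewrite /mult eqxx; lia.
Qed.

Lemma max_even_mem_encode : part_size a b \in encode_seq a h.
Proof.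
apply/mem_encodeP; exists b; split=> //; first by rewrite /b; lia.
by rewrite /mult eqxx; lia.
Qed.

Lemma encode_intpart : is_intpart (encode_seq a h).
Proof.
apply/andP; split; first by apply: sort_sorted => x y /=; apply: leq_total.
by apply/allP => x /mem_encodeP[i [_ -> _]]; rewrite /part_size; lia.
Qed.

Variable p : intpart.
Hypothesis pE : parts p = encode_seq a h.

Lemma weight_encode :
  weight p = 2 * (\sum_(i < size h) nth 0 h i * part_size a i)
             + (2 * a).-1 + 2 * b.
Proof.
by rewrite /weight pE sumn_encode sum_mult /part_size /b; lia.
Qed.

Lemma max_odd_encode : max_odd p = part_size a a.-1.
Proof.
rewrite /max_odd pE; apply: bigmax_seq_eq.
- exact: max_odd_mem_encode.
- by rewrite odd_part_size; lia.
move=> _ /mem_encodeP[i [_ -> _]]; rewrite odd_part_size /part_size; lia.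
Qed.

Lemma max_even_encode : max_even p = part_size a b.
Proof.
rewrite /max_even pE; apply: bigmax_seq_eq.
- exact: max_even_mem_encode.
- by rewrite odd_part_size /b; lia.
move=> _ /mem_encodeP[i [ih -> _]]; rewrite odd_part_size /part_size /b; lia.
Qed.

Lemma nb_odd_encode :
  nb_odd p = 2 * (\sum_(i < size h) nth 0 h i * (i < a)) + 1.
Proof.
rewrite /nb_odd pE count_encode.
under eq_bigr do rewrite odd_part_size.
by rewrite (sum_mult (fun i => i < a : nat)) /b; lia.
Qed.

(** Pairs do not affect the parity of a column length, so column [j] has odd length exactly when it
    meets one of the two unpaired rows but not both, that is when [2 * a - 1 <= j < 2 * b]. *)
Lemma nb_odd_conjugate_encode :
  nb_odd (conjugate p) = 2 * b - (2 * a).-1.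
Proof.
rewrite (@nb_odd_conjugate _ (2 * b)); last first.
  rewrite pE; apply/allP => _ /mem_encodeP[i [ih -> _]].
  by rewrite /part_size /b; lia.
have ab : (2 * a).-1 <= 2 * b by rewrite /b; lia.
rewrite -[in iota _ _](subnKC ab) iotaD count_cat add0n.
have oddE j : odd (count (fun x => j < x) p) =
    (j < part_size a a.-1) (+) (j < part_size a b).
  rewrite pE count_encode (sum_mult (fun i => j < part_size a i : nat)).
  by rewrite mul2n 2!oddD odd_double !oddb.
rewrite (@eq_in_count _ _ pred0) ?count_pred0; last first.
  by move=> j; rewrite mem_iota oddE /part_size /b /=; lia.
rewrite (@eq_in_count _ _ predT) ?count_predT ?size_iota // => j.
by rewrite mem_iota oddE /part_size /b /=; lia.
Qed.

Lemma OEbar_encode : OEbar p.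
Proof.
split; rewrite ?pE.
- move=> _ _ /mem_encodeP[i [_ -> _]] /mem_encodeP[j [_ -> _]].
  by rewrite !odd_part_size /part_size; lia.
- apply/hasP; exists (part_size a a.-1); first exact: max_odd_mem_encode.
  by rewrite odd_part_size; lia.
- apply/hasP; exists (part_size a b); first exact: max_even_mem_encode.
  by rewrite /= odd_part_size /b; lia.
move=> _ /mem_encodeP[i [ih -> _]].
rewrite max_odd_encode max_even_encode count_mem_encode // /mult -/b.
by rewrite /part_size /b; split; lia.
Qed.

End Encoding.

(* With [a] and [b] the levels of [p], the largest odd part is [2 * a - 1] and
   the largest even part is [2 * b]. *)
Definition odd_level (p : intpart) : nat := (max_odd p).+1./2.
Definition even_level (p : intpart) : nat := (max_even p)./2.

(** * Recovering the half multiplicities from a partition in [OEbar] *)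

Section Decoding.
Variable p : intpart.
Hypothesis OEp : OEbar p.

Lemma max_odd_mem : odd (max_odd p) /\ max_odd p \in parts p.
Proof. by case: OEp => _ /bigmax_seq_mem. Qed.

Lemma max_even_mem : ~~ odd (max_even p) /\ max_even p \in parts p.
Proof. by case: OEp => _ _ /bigmax_seq_mem. Qed.

Lemma max_odd_lt_even : max_odd p < max_even p.
Proof.
have [[o op] [e ep]] := (max_odd_mem, max_even_mem).
by case: OEp => lt_oe _ _ _; apply: lt_oe.
Qed.

Lemma odd_level_gt0 : 0 < odd_level p.
Proof. by have [o _] := max_odd_mem; rewrite /odd_level; lia. Qed.

Lemma leq_odd_even_level : odd_level p <= even_level p.
Proof. by have := max_odd_lt_even; rewrite /odd_level /even_level; lia. Qed.

(** Rounding down in [./2] discards the unpaired copy of each of the two largest parts. *)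
Definition decode : seq nat :=
  mkseq (fun i => (count_mem (part_size (odd_level p) i) p)./2)
        (even_level p).+1.

Lemma size_decode : size decode = (even_level p).+1.
Proof. exact: size_mkseq. Qed.

(** An odd part is at most the largest odd part, so its index lies below the odd level; an even part
    exceeds all odd parts, so its index does not. In both cases halving gives the index. *)
Lemma mem_part_size x : x \in parts p ->
  x = part_size (odd_level p) x./2 /\ x./2 < size decode.
Proof.
have [[o op] [e ep]] := (max_odd_mem, max_even_mem).
move=> xp; rewrite size_decode /part_size /odd_level /even_level.
have [lt_oe _ _ _] := OEp.
have [xo|xe] := boolP (odd x).
  have : x <= max_odd p by apply: (leq_bigmax_seq (F := id)).
  by have := max_odd_lt_even; lia.
have : x <= max_even p by apply: (leq_bigmax_seq (F := id)).
by have := lt_oe _ _ op xp o xe; lia.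
Qed.

Lemma mult_decode i : i < size decode ->
  mult (odd_level p) decode i = count_mem (part_size (odd_level p) i) p.
Proof.
rewrite size_decode => ib; rewrite /mult size_decode nth_mkseq // succnK.
have [[o op] [e ep]] := (max_odd_mem, max_even_mem).
have a0 := odd_level_gt0; have ab := leq_odd_even_level.
have oE : max_odd p = part_size (odd_level p) (odd_level p).-1.
  by move: a0; rewrite /part_size /odd_level; lia.
have eE : max_even p = part_size (odd_level p) (even_level p).
  by move: ab; rewrite /part_size /odd_level /even_level; lia.
have [ip|ip] := boolP (part_size (odd_level p) i \in parts p).
  have [_ _ _ /(_ _ ip) odd_count] := OEp; rewrite oE eE in odd_count.
  set c := count_mem _ _ in odd_count *.
  (* The two exceptional indices differ because [odd_level p <= even_level p], so at most one
     indicator in [mult] is 1, and it restores the remainder lost in [c./2]. *)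
  have : odd c = (i == (odd_level p).-1) || (i == even_level p).
    apply/idP/orP => [/odd_count|oc]; last first.
      by apply/odd_count; case: oc => /eqP ->; [left|right].
    by case=> /part_size_inj ->; rewrite eqxx; [left|right].
  by lia.
(* Both largest parts do occur in [p], so an absent size has neither exceptional index. *)
rewrite (count_memPn ip).
have /negbTE -> : i != (odd_level p).-1.
  by apply: contraNneq ip => ->; rewrite -oE.
by have /negbTE -> : i != even_level p by apply: contraNneq ip => ->; rewrite -eE.
Qed.

(** Weakly decreasing sequences are determined by their multiplicities, and these agree by
    [mult_decode]. *)
Lemma decodeK : encode_seq (odd_level p) decode = parts p.
Proof.
have a0 := odd_level_gt0.
have ah : odd_level p < size decode by rewrite size_decode ltnS leq_odd_even_level.
have /andP[sorted_h _] := encode_intpart a0 ah.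
have geq_anti : antisymmetric geq by move=> x y /=; lia.
apply: (sorted_eq geq_trans geq_anti) => //; first exact: intpart_sorted.
have count_eq i : i < size decode ->
    count_mem (part_size (odd_level p) i) (encode_seq (odd_level p) decode) =
    count_mem (part_size (odd_level p) i) p.
  by move=> ih; rewrite count_mem_encode // mult_decode.
apply/allP => x; rewrite mem_cat => /orP[/mem_encodeP[i [ih -> _]]|xp].
  by rewrite /= count_eq.
by have [xE xh] := mem_part_size xp; rewrite xE /= count_eq.
Qed.

End Decoding.

Lemma encode_seq_inj a h h' : 0 < a -> a < size h -> size h = size h' ->
  encode_seq a h = encode_seq a h' -> h = h'.
Proof.
move=> a0 ah hh' E; apply: (@eq_from_nth _ 0) => // i ih.
have := congr1 (count_mem (part_size a i)) E.
by rewrite !count_mem_encode -?hh' // /mult -hh'; lia.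
Qed.

(** The empty partition is only a default that makes the map total; [parts_encode] applies once
    [0 < a < size h]. *)
Definition encode (a : nat) (h : seq nat) : intpart :=
  insubd (IntPart (isT : is_intpart [::])) (encode_seq a h).

Lemma parts_encode a h : 0 < a -> a < size h ->
  parts (encode a h) = encode_seq a h.
Proof.
move=> a0 ah; apply: (insubdK (IntPart (isT : is_intpart [::]))).
exact: encode_intpart.
Qed.

(** For fixed levels the half multiplicities are unconstrained, which is what makes the generating
    function factor. *)
Lemma encode_bij a b : 0 < a -> a <= b ->
  set_bij [set h | size h = b.+1]%classic
    [set p : intpart | (OEbar p /\ odd_level p = a) /\ even_level p = b]%classic
    (encode a).
Proof.
move=> a0 ab; split=> [h /= hb|h h' hb h'b|p [[OEp pa] pb]].
- have ah : a < size h by rewrite hb ltnS.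
  have pE := parts_encode a0 ah; split; first split.
  + exact: OEbar_encode pE.
  + by rewrite /odd_level (max_odd_encode a0 ah pE) /part_size; lia.
  + by rewrite /even_level (max_even_encode a0 ah pE) /part_size hb; lia.
- move/set_mem: hb => /= hb; move/set_mem: h'b => /= h'b.
  move/(congr1 parts); rewrite !parts_encode ?hb ?h'b //.
  by apply: encode_seq_inj; rewrite ?hb ?h'b.
exists (decode p); first by rewrite -pb; exact: size_decode.
apply: val_inj; rewrite -pa -[LHS]/(parts _) parts_encode ?decodeK ?odd_level_gt0 //.
by rewrite size_decode ltnS leq_odd_even_level.
Qed.

Local Open Scope ring_scope.
Local Open Scope classical_set_scope.

(** * Orders of vanishing of power series *)

Section Order.
Variable R : comNzRingType.
Implicit Types a b c : fps R.

(** Divisibility by the [N]-th power of the variable. Applied to differences it expresses congruence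
    modulo that power, through which infinite sums are compared with finite ones. *)
Definition fps_ord (N : nat) a : Prop := forall k, (k < N)%N -> fcoef a k = 0.

Lemma fcoefD a b k : fcoef (a + b) k = fcoef a k + fcoef b k.
Proof. by []. Qed.

Lemma fcoefN a k : fcoef (- a) k = - fcoef a k.
Proof. by []. Qed.

Lemma fcoefM a b k :
  fcoef (a * b) k = \sum_(i < k.+1) fcoef a i * fcoef b (k - i).
Proof. by []. Qed.

Lemma fcoef_sum (I : Type) (r : seq I) (F : I -> fps R) k :
  fcoef (\sum_(i <- r) F i) k = \sum_(i <- r) fcoef (F i) k.
Proof. by elim/big_rec2: _ => // i x y _ <-. Qed.

Lemma fps_ord0 a : fps_ord 0 a.
Proof. by []. Qed.

Lemma fps_ord_leq M N a : (M <= N)%N -> fps_ord N a -> fps_ord M a.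
Proof. by move=> MN aN k kM; apply: aN; apply: leq_trans MN. Qed.

Lemma fps_ordD N a b : fps_ord N a -> fps_ord N b -> fps_ord N (a + b).
Proof. by move=> aN bN k kN; rewrite fcoefD aN // bN // addr0. Qed.

Lemma fps_ordN N a : fps_ord N a -> fps_ord N (- a).
Proof. by move=> aN k kN; rewrite fcoefN aN // oppr0. Qed.

Lemma fps_ordB N a b : fps_ord N a -> fps_ord N b -> fps_ord N (a - b).
Proof. by move=> aN bN; apply: fps_ordD => //; apply: fps_ordN. Qed.

Lemma fps_ord_sum N (I : eqType) (r : seq I) (F : I -> fps R) :
  (forall i, i \in r -> fps_ord N (F i)) -> fps_ord N (\sum_(i <- r) F i).
Proof.
move=> FN; rewrite big_seq; elim/big_ind: _ => //.
by move=> a b; apply: fps_ordD.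
Qed.

Lemma fps_ordM M N a b :
  fps_ord M a -> fps_ord N b -> fps_ord (M + N) (a * b).
Proof.
move=> aM bN k kMN; rewrite fcoefM big1 // => i _.
have [iM|Mi] := ltnP i M; first by rewrite aM // mul0r.
by rewrite bN ?mulr0 //; have := ltn_ord i; lia.
Qed.

Lemma fps_ordMl N a b : fps_ord N b -> fps_ord N (a * b).
Proof. exact: (@fps_ordM 0). Qed.

Lemma fps_ordMr N a b : fps_ord N a -> fps_ord N (a * b).
Proof. by rewrite mulrC; apply: fps_ordMl. Qed.

Lemma fps_ordX M n a : fps_ord M a -> fps_ord (M * n) (a ^+ n).
Proof.
move=> aM; elim: n => [|n IH]; first by rewrite muln0.
by rewrite exprS mulnS; apply: fps_ordM.
Qed.

Lemma fps_ord1X n a : fps_ord 1 a -> fps_ord n (a ^+ n).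
Proof. by move=> a1; rewrite -{1}[n]mul1n; apply: fps_ordX. Qed.

Lemma fps_ord_eq0 a : (forall N, fps_ord N a) -> a = 0.
Proof. by move=> aN; apply: fpsP => k; apply: (aN k.+1). Qed.

Lemma fps_eq_modX a b : (forall N, fps_ord N (a - b)) -> a = b.
Proof. by move=> /fps_ord_eq0/eqP; rewrite subr_eq0 => /eqP. Qed.

Lemma fps_ord_subr_unit a : fps_ord 1 a -> 1 - a \is a GRing.unit.
Proof.
by move=> a1; apply: fps_unit_coef0; rewrite fcoefD fcoefN a1 // subr0.
Qed.

End Order.

(** * Infinite sums of power series *)

Section Sums.
Variable R : comNzRingType.

Lemma eq_fps_sum (I : choiceType) (A : set I) (F G : I -> fps R) :
  (forall i, A i -> F i = G i) -> fps_sum A F = fps_sum A G.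
Proof.
move=> FG; apply: fpsP => k /=; apply: eq_fsbigr => i /set_mem Ai.
by rewrite FG.
Qed.

Lemma fps_sum_reindex (I J : choiceType) (A : set I) (B : set J) (h : I -> J)
    (F : J -> fps R) :
  set_bij A B h -> fps_sum B F = fps_sum A (F \o h).
Proof. by move=> bij; apply: fpsP => k /=; apply: reindex_fsbig. Qed.

Lemma fps_sum_approx (I : choiceType) (A : set I) (F : I -> fps R) (r : seq I)
    (N : nat) :
  uniq r -> (forall i, i \in r -> A i) ->
  (forall i, A i -> i \notin r -> fps_ord N (F i)) ->
  fps_ord N (fps_sum A F - \sum_(i <- r) F i).
Proof.
move=> ur rA rF k kN; rewrite fcoefD fcoefN fcoef_sum /=.
rewrite (fsbigE r) //=; last by move=> i Ai ir; apply: rF.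
rewrite (big_rmcond_in (fun i => i \in A)) ?subrr // => i ir.
by rewrite (mem_set (rA i ir)).
Qed.

(** By induction on [N]: summability gives finitely many indices with a nonzero coefficient at [N],
    and these are joined to the earlier list. *)
Lemma fps_summable_approx (I : choiceType) (A : set I) (F : I -> fps R)
    (N : nat) : fps_summable A F ->
  exists r : seq I, [/\ uniq r, forall i, i \in r -> A i &
    forall i, A i -> i \notin r -> fps_ord N (F i)].
Proof.
move=> sF; elim: N => [|N [r [ur rA rF]]]; first by exists [::].
have /finite_seqP[X XE] := sF N.
exists (undup (r ++ X)); split=> [|i|i Ai]; first exact: undup_uniq.
  rewrite mem_undup mem_cat => /orP[/rA//|iX].
  by have : [set` X] i by []; rewrite -XE => -[].
rewrite mem_undup mem_cat negb_or => /andP[ir iX] k.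
rewrite ltnS leq_eqVlt => /orP[/eqP->|kN]; last exact: rF.
apply/eqP; apply: contraT => Fi; apply: contraNT iX => _.
suff : [set` X] i by [].
by rewrite -XE.
Qed.


Lemma fps_sumMl (I : choiceType) (A : set I) (F : I -> fps R) (c : fps R) :
  fps_summable A F -> fps_sum A (fun i => c * F i) = c * fps_sum A F.
Proof.
move=> sF; apply: fps_eq_modX => N.
have [r [ur rA rF]] := fps_summable_approx N sF.
have h1 := fps_sum_approx ur rA rF.
have h2 : fps_ord N (fps_sum A (fun i => c * F i) - \sum_(i <- r) c * F i).
  by apply: fps_sum_approx => // i Ai ir; apply/fps_ordMl/rF.
have -> : fps_sum A (fun i => c * F i) - c * fps_sum A F =
   (fps_sum A (fun i => c * F i) - \sum_(i <- r) c * F i)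
   - c * (fps_sum A F - \sum_(i <- r) F i).
  by rewrite -mulr_sumr; ring.
by apply: fps_ordB => //; apply: fps_ordMl.
Qed.

(** Modulo each power of the variable, both sides reduce to the same finite sum over [r], on the
    right grouped by the value of [g]. *)
Lemma fps_sum_fibers (I J : choiceType) (A : set I) (B : set J) (g : I -> J)
    (F : I -> fps R) :
  fps_summable A F -> (forall i, A i -> B (g i)) ->
  fps_sum A F = fps_sum B (fun j => fps_sum [set i | A i /\ g i = j] F).
Proof.
move=> sF AB; apply: fps_eq_modX => N.
have [r [ur rA rF]] := fps_summable_approx N sF.
pose G j := fps_sum [set i | A i /\ g i = j] F.
have GE j : fps_ord N (G j - \sum_(i <- r | g i == j) F i).
  rewrite -big_filter; apply: fps_sum_approx; first exact: filter_uniq.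
    by move=> i; rewrite mem_filter => /andP[/eqP gi /rA].
  move=> i [Ai gi]; rewrite mem_filter gi eqxx /=; exact: rF.
pose rJ := undup (map g r).
have h1 : fps_ord N (fps_sum B G - \sum_(j <- rJ) G j).
  apply: fps_sum_approx; first exact: undup_uniq.
    by move=> j; rewrite mem_undup => /mapP[i /rA Ai ->]; apply: AB.
  (* A fiber that contains no index of [r] has a sum of order at least [N]. *)
  move=> j Bj jr; have := GE j; rewrite big1_seq ?subr0 //.
  move=> i /andP[/eqP gi ir]; case/negP: jr.
  by rewrite mem_undup -gi map_f.
have h2 : fps_ord N (\sum_(j <- rJ) G j - \sum_(i <- r) F i).
  have -> : \sum_(i <- r) F i = \sum_(j <- rJ) \sum_(i <- r | g i == j) F i.
    rewrite (exchange_big_dep xpredT) //= [LHS]big_seq [RHS]big_seq.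
    apply: eq_bigr => i ir.
    rewrite big_mkcond (bigD1_seq (g i)) ?undup_uniq ?mem_undup ?map_f //=.
    by rewrite eqxx big1 ?addr0 // => j; rewrite eq_sym => /negbTE ->.
  by rewrite -sumrB; apply: fps_ord_sum => j _; apply: GE.
have -> : fps_sum A F - fps_sum B G = (fps_sum A F - \sum_(i <- r) F i)
   - (fps_sum B G - \sum_(j <- rJ) G j)
   - (\sum_(j <- rJ) G j - \sum_(i <- r) F i) by ring.
by do 2!apply: fps_ordB => //; apply: fps_sum_approx.
Qed.

(** A convenient sufficient condition for summability: modulo the [N]-th power only the first [N]
    terms matter. *)
Definition fps_growing (u : nat -> fps R) : Prop := forall n, fps_ord n (u n).

Lemma fps_growing_summable (A : set nat) (u : nat -> fps R) :
  fps_growing u -> fps_summable A u.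
Proof.
move=> gu k; apply: sub_finite_set (finite_II k.+1) => n [_ /= un].
by rewrite ltnS leqNgt; apply: contraNN un => kn; rewrite gu.
Qed.

Lemma fps_growing_approx (u : nat -> fps R) (M N : nat) :
  fps_growing u -> (N <= M)%N ->
  fps_ord N (fps_sum setT u - \sum_(i < M) u i).
Proof.
move=> gu NM; rewrite -(big_mkord xpredT u).
apply: fps_sum_approx => //; first exact: iota_uniq.
move=> i _; rewrite mem_index_iota /= -leqNgt => Mi.
by apply: fps_ord_leq (gu i); apply: leq_trans Mi.
Qed.

Lemma fps_sum_recl (u : nat -> fps R) :
  fps_growing u -> fps_sum setT u = u 0%N + fps_sum setT (u \o succn).
Proof.
move=> gu; apply: fps_eq_modX => N.
have guS : fps_growing (u \o succn).
  by move=> n; apply: fps_ord_leq (leqnSn n) (gu n.+1).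
have := fps_ordB (fps_growing_approx gu (leqnSn N))
  (fps_growing_approx guS (leqnn N)).
rewrite big_ord_recl /=; set s := fps_sum _ _; set s' := fps_sum _ _.
by congr (fps_ord _ _); rewrite /bump /=; ring.
Qed.

Lemma fps_sumD (u v : nat -> fps R) :
  fps_growing u -> fps_growing v ->
  fps_sum setT (fun n => u n + v n) = fps_sum setT u + fps_sum setT v.
Proof.
move=> gu gv; apply: fps_eq_modX => N.
have guv : fps_growing (fun n => u n + v n) by move=> n; apply: fps_ordD.
have := fps_ordB (fps_ordB (fps_growing_approx guv (leqnn N))
  (fps_growing_approx gu (leqnn N))) (fps_growing_approx gv (leqnn N)).
rewrite big_split /=; congr (fps_ord _ _); ring.
Qed.

(** Splitting off the first term shows that the sum [s] satisfies [s = 1 + w * s], and [1 - w] is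
    invertible. *)
Lemma fps_geometric (w : fps R) :
  fps_ord 1 w -> fps_sum setT (fun n => w ^+ n) = (1 - w)^-1.
Proof.
move=> w1.
have gw : fps_growing (fun n => w ^+ n).
  by move=> n; apply: fps_ord1X.
have E : fps_sum setT (fun n => w ^+ n) =
    1 + w * fps_sum setT (fun n => w ^+ n).
  rewrite -fps_sumMl; last exact: fps_growing_summable.
  rewrite [LHS]fps_sum_recl // expr0; congr (1 + _).
  by apply: eq_fps_sum => n _; rewrite /= exprS.
rewrite -[LHS](mulrK (fps_ord_subr_unit w1)).
by rewrite mulrBr mulr1 [_ * w]mulrC {1}E addrK mul1r.
Qed.

End Sums.


(** * Generating functions of free multiplicity vectors *)

Section MultiplicityProduct.
Variable R : comNzRingType.
Implicit Types (w : nat -> fps R) (h : seq nat).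

Definition monom w h : fps R := \prod_(i < size h) w i ^+ nth 0%N h i.

Lemma monom_cons w x h : monom w (x :: h) = w 0%N ^+ x * monom (w \o succn) h.
Proof. by rewrite /monom /= big_ord_recl. Qed.

Lemma fps_ord_monom w h :
  (forall i, fps_ord 1 (w i)) -> fps_ord (sumn h) (monom w h).
Proof.
elim: h w => [|x h IH] w w1; first exact: fps_ord0.
rewrite monom_cons /=; apply: fps_ordM; last by apply: IH => i; apply: w1.
by apply: fps_ord1X.
Qed.

Lemma monom_summable w k :
  (forall i, fps_ord 1 (w i)) ->
  fps_summable [set h | size h = k] (monom w).
Proof.
move=> w1 n; apply: sub_finite_set (finite_bounded_seqs k n) => h [/= <-].
move=> hn; split=> //; apply: sub_all (leq_sumn h) => x /leq_trans; apply.
by rewrite leqNgt; apply: contraNN hn => nh; rewrite (fps_ord_monom w1).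
Qed.

(** Sorting the sequences by their first entry leaves a geometric series in [w 0] times the same sum
    for one entry fewer and shifted weights. *)
Lemma fps_sum_monom w k :
  (forall i, fps_ord 1 (w i)) ->
  fps_sum [set h | size h = k] (monom w) = (\prod_(i < k) (1 - w i))^-1.
Proof.
elim: k w => [|k IH] w w1.
  rewrite big_ord0 invr1.
  have -> : [set h : seq nat | size h = 0%N] = [set [::]].
    by apply/seteqP; split=> h /= => [/size0nil|->].
  by apply: fpsP => n /=; rewrite fsbig_set1 /monom /= big_ord0.
rewrite (@fps_sum_fibers _ _ _ _ setT (head 0%N)) //; last exact: monom_summable.
have wS1 i : fps_ord 1 ((w \o succn) i) by apply: w1.
transitivity (fps_sum setT (fun x => fps_sum [set h | size h = k]
    (fun h => w 0%N ^+ x * monom (w \o succn) h))).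
  apply: eq_fps_sum => x _.
  rewrite (@fps_sum_reindex _ _ _ [set h | size h = k] _ (cons x)).
    by apply: eq_fps_sum => h _; rewrite /= monom_cons.
  split=> [h /= ->|h h' _ _ []|[|y h] [] //= [hk] ->] //.
  by exists h.
under eq_fps_sum do rewrite (fps_sumMl _ (monom_summable k wS1)) IH // mulrC.
rewrite fps_sumMl; last first.
  by apply: fps_growing_summable => n; apply: fps_ord1X.
rewrite fps_geometric // big_ord_recl invrM ?fps_ord_subr_unit //.
by apply: rpred_prod => i _; apply: fps_ord_subr_unit.
Qed.

End MultiplicityProduct.

(** * The q-series transformation between the two single sums *)

Section QSeries.
Variable R : comNzRingType.

Lemma qpoch_recl (a Q : fps R) n : qpoch a Q n.+1 = (1 - a) * qpoch (a * Q) Q n.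
Proof.
rewrite /qpoch big_ord_recl expr0 mulr1; congr (_ * _).
by apply: eq_bigr => i _; rewrite -mulrA -exprS.
Qed.

Lemma qpoch_recr (a Q : fps R) n : qpoch a Q n.+1 = qpoch a Q n * (1 - a * Q ^+ n).
Proof. by rewrite /qpoch big_ord_recr. Qed.

Lemma qpoch_unit (a Q : fps R) n : fps_ord 1 a -> qpoch a Q n \is a GRing.unit.
Proof.
by move=> a1; apply: rpred_prod => i _; apply/fps_ord_subr_unit/fps_ordMr.
Qed.

Variables x Q : fps R.
Hypothesis x1 : fps_ord 1 x.
Hypothesis Q1 : fps_ord 1 Q.

Let ordQ a : (0 < a)%N -> fps_ord 1 (Q ^+ a).
Proof. by move=> a0; apply: fps_ord_leq a0 (fps_ord1X Q1). Qed.

Let G a := fps_sum setT (fun c => x ^+ c / qpoch (Q ^+ a) Q c.+1).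
Let F a := fps_sum setT (fun n => Q ^+ (a * n) / qpoch x Q n.+1).

Lemma growing_lhs a :
  fps_growing (fun c => x ^+ c / qpoch (Q ^+ a) Q c.+1).
Proof. by move=> c; apply/fps_ordMr/fps_ord1X. Qed.

(** The offset [m] covers the denominators of lengths [n] and [n + 1] that both occur in [F_rec]. *)
Lemma growing_rhs a m : (0 < a)%N ->
  fps_growing (fun n => Q ^+ (a * n) / qpoch x Q (m + n)).
Proof. by move=> a0 n; apply/fps_ordMr; rewrite exprM; apply/fps_ord1X/ordQ. Qed.

(** Every denominator of [G a] contains the factor [1 - Q ^+ a]. Removing it leaves 1 from the term
    [c = 0] and [x * G a.+1] from the others. *)
Let G_rec a : (0 < a)%N -> G a = 1 + x * G a.+1 + Q ^+ a * G a.
Proof.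
move=> a0; pose y := 1 - Q ^+ a.
have yU : y \is a GRing.unit by apply/fps_ord_subr_unit/ordQ.
suff E : G a = y^-1 * (1 + x * G a.+1).
  have : y * G a = 1 + x * G a.+1 by rewrite E mulVKr.
  by move=> <-; rewrite /y; ring.
rewrite mulrDr mulr1.
have gG := @growing_lhs a.
rewrite mulrA -fps_sumMl; last exact/fps_growing_summable/growing_lhs.
rewrite {1}/G fps_sum_recl //.
congr (_ + _).
  by rewrite expr0 mul1r /qpoch big_ord1 expr0 mulr1.
apply: eq_fps_sum => c _ /=; rewrite qpoch_recl -exprSr exprS invrM //.
  by rewrite -/y; ring.
exact/qpoch_unit/ordQ.
Qed.

(** In the [n]-th term write 1 as [(1 - x * Q ^+ n) + x * Q ^+ n]. The first summand cancels the
    last factor of the denominator and yields [1 + Q ^+ a * F a] after a shift of [n]; the second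
    yields [x * F a.+1]. *)
Let F_rec a : (0 < a)%N -> F a = 1 + x * F a.+1 + Q ^+ a * F a.
Proof.
move=> a0; rewrite addrAC.
have gF := @growing_rhs a 1 a0; have gFS := @growing_rhs a.+1 1 isT.
have gF0 := @growing_rhs a 0 a0.
have gxF : fps_growing (fun n => x * (Q ^+ (a.+1 * n) / qpoch x Q (1 + n))).
  by move=> n; apply/fps_ordMl/gFS.
transitivity (fps_sum setT (fun n => Q ^+ (a * n) / qpoch x Q n +
    x * (Q ^+ (a.+1 * n) / qpoch x Q (1 + n)))).
  apply: eq_fps_sum => n _; rewrite add1n qpoch_recr.
  have yU : 1 - x * Q ^+ n \is a GRing.unit.
    exact/fps_ord_subr_unit/fps_ordMr.
  rewrite invrM ?qpoch_unit // mulSn exprD.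
  set P := qpoch x Q n; set y := 1 - x * Q ^+ n in yU *.
  have -> : Q ^+ (a * n) * P^-1 = Q ^+ (a * n) * (y * (y^-1 * P^-1)).
    by rewrite mulVKr.
  by set i := y^-1 * _; rewrite /y; ring.
rewrite fps_sumD //; congr (_ + _); last first.
  by rewrite fps_sumMl //; apply: fps_growing_summable.
rewrite fps_sum_recl //.
congr (_ + _); first by rewrite muln0 expr0 /qpoch big_ord0 divr1.
rewrite -fps_sumMl; last exact: fps_growing_summable.
by apply: eq_fps_sum => n _; rewrite /= mulnS exprD mulrA.
Qed.

(* Both sides satisfy [S a = 1 + x S (a + 1) + Q ^ a S a], and the recurrence
   for the difference raises the order of vanishing. *)
Lemma qpoch_sum_duality a : (0 < a)%N ->
  fps_sum setT (fun c => x ^+ c / qpoch (Q ^+ a) Q c.+1) =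
  fps_sum setT (fun n => Q ^+ (a * n) / qpoch x Q n.+1).
Proof.
move=> a0; apply: fps_eq_modX => N; rewrite -/(G a) -/(F a).
elim: N a a0 => [|N IH] a a0; first exact: fps_ord0.
have -> : G a - F a = x * (G a.+1 - F a.+1) + Q ^+ a * (G a - F a).
  by rewrite {1}G_rec // {1}F_rec //; ring.
by rewrite -add1n; apply: fps_ordD; apply: fps_ordM; auto.
Qed.

End QSeries.

(** * Assembling the generating function of [OEbar] *)

Section GeneratingFunction.

(** The contribution of one pair of parts of the [i]-th size; only odd pairs carry a power of
    [z]. *)
Definition size_weight (a i : nat) : fps laurent :=
  (z ^+ 2) ^+ (i < a)%N * q ^+ (2 * part_size a i).

Lemma fps_ord_q : fps_ord 1 q.
Proof. by case. Qed.

Lemma fps_ord_qX n : fps_ord n (q ^+ n).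
Proof. exact/fps_ord1X/fps_ord_q. Qed.

Lemma fps_ord_size_weight a i : (0 < a)%N -> fps_ord 1 (size_weight a i).
Proof.
move=> a0; apply/fps_ordMl/(fps_ord_leq _ (@fps_ord_qX _)).
by rewrite /part_size; lia.
Qed.

Lemma monom_size_weight a h : monom (size_weight a) h =
  z ^+ (2 * \sum_(i < size h) nth 0%N h i * (i < a))%N *
  q ^+ (2 * \sum_(i < size h) nth 0%N h i * part_size a i)%N.
Proof.
rewrite /monom !big_distrr /= -!prodrXr -big_split /=.
apply: eq_bigr => i _; rewrite exprMn -!exprM; congr (z ^+ _ * q ^+ _); lia.
Qed.

Lemma srank_weight_encode a h (p : intpart) :
  (0 < a)%N -> (a < size h)%N -> parts p = encode_seq a h ->
  z ^ srank p * q ^+ weight p =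
  z^-1 ^+ (2 * ((size h).-1 - a))%N * q ^+ ((2 * a).-1 + 2 * (size h).-1)%N
  * monom (size_weight a) h.
Proof.
move=> a0 ah pE; rewrite monom_size_weight (weight_encode a0 ah pE) /srank.
rewrite (nb_odd_encode a0 ah pE) (nb_odd_conjugate_encode a0 ah pE).
set S := (\sum_(i < size h) _ * (_ < _))%N; set W := (\sum_(i < size h) _)%N.
set b := (size h).-1.
(* Since [a <= b], the natural-number subtractions are exact, and the 1 from the unpaired odd part
   cancels the 1 in [2 * (b - a) + 1]. *)
have -> : (2 * S + 1)%:Z - (2 * b - (2 * a).-1)%:Z =
    (2 * S)%:Z - (2 * (b - a))%:Z by rewrite /b; lia.
rewrite exprzDr ?z_unit // -exprnP -exprnN -addnA exprD -exprVn.
by ring.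
Qed.

(** The first [a] factors belong to the odd sizes, the remaining [c.+1] to the even sizes from
    [2 * a] on. *)
Lemma prod_size_weight a c : (0 < a)%N ->
  \prod_(i < a + c.+1) (1 - size_weight a i) =
  qpoch (z ^+ 2 * q ^+ 2) (q ^+ 4) a * qpoch ((q ^+ 4) ^+ a) (q ^+ 4) c.+1.
Proof.
move=> a0; rewrite big_split_ord; congr (_ * _); apply: eq_bigr => i _ /=.
  rewrite /size_weight /part_size ltn_ord expr1 -[in RHS]mulrA -!exprM -exprD.
  by congr (1 - _ * _ ^+ _); lia.
rewrite /size_weight /part_size ltnNge leq_addr /= expr0 mul1r -!exprM -exprD.
by congr (1 - _ ^+ _); lia.
Qed.

Lemma lhs_summable (A : set intpart) :
  fps_summable A (fun p => z ^ srank p * q ^+ weight p).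
Proof.
move=> n; apply: sub_finite_set (finite_weight_le n) => p [_ /=].
rewrite leqNgt; apply: contraNN => np.
by apply/eqP; apply: (fps_ordMl (z ^ srank p) (@fps_ord_qX (weight p))).
Qed.

Lemma fps_sum_level a b : (0 < a)%N -> (a <= b)%N ->
  fps_sum [set p | (OEbar p /\ odd_level p = a) /\ even_level p = b]
    (fun p => z ^ srank p * q ^+ weight p) =
  z^-1 ^+ (2 * (b - a))%N * q ^+ ((2 * a).-1 + 2 * b)%N
  * (\prod_(i < b.+1) (1 - size_weight a i))^-1.
Proof.
move=> a0 ab; rewrite (fps_sum_reindex _ (encode_bij a0 ab)).
have w1 i := @fps_ord_size_weight a i a0.
rewrite -(fps_sum_monom b.+1 w1) -fps_sumMl; last exact: monom_summable.
apply: eq_fps_sum => h /= hb.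
by rewrite (srank_weight_encode a0 _ (parts_encode a0 _)) ?hb.
Qed.

Lemma set_bij_addn a : set_bij setT [set b | (a <= b)%N] (addn a).
Proof.
split=> [n _|m n _ _ /addnI//|b /= ab]; first exact: leq_addr.
by exists (b - a)%N; rewrite ?subnKC.
Qed.

Lemma fps_sum_odd_level a : (0 < a)%N ->
  fps_sum [set p | OEbar p /\ odd_level p = a]
    (fun p => z ^ srank p * q ^+ weight p) =
  fps_sum [set n | (1 <= n)%N] (fun n => q ^+ (4 * a * n - 1)%N
      / (qpoch (z ^+ 2 * q ^+ 2) (q ^+ 4) a
         * qpoch (q ^+ 2 / z ^+ 2) (q ^+ 4) n)).
Proof.
move=> a0; pose Q : fps laurent := q ^+ 4; pose x := q ^+ 2 / z ^+ 2.
have x1 : fps_ord 1 x by apply/fps_ordMr/(fps_ord_leq _ (@fps_ord_qX 2)).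
have Q1 : fps_ord 1 Q by apply: (fps_ord_leq _ (@fps_ord_qX 4)).
have Qa1 : fps_ord 1 (Q ^+ a) by apply/(fps_ord_leq a0)/fps_ord1X.
have zq1 : fps_ord 1 (z ^+ 2 * q ^+ 2).
  by apply/fps_ordMl/(fps_ord_leq _ (@fps_ord_qX 2)).
pose C := q ^+ (4 * a - 1) / qpoch (z ^+ 2 * q ^+ 2) Q a.
(* Here [c] is the even level minus [a]: each unit of [c] adds 2 to the largest even part and so
   contributes [x], that is [q ^+ 2 / z ^+ 2]. *)
transitivity (C * fps_sum setT (fun c => x ^+ c / qpoch (Q ^+ a) Q c.+1)).
  rewrite (@fps_sum_fibers _ _ _ _ [set b | (a <= b)%N] even_level); first last.
  - by move=> p [OEp <-]; apply: leq_odd_even_level.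
  - exact: lhs_summable.
  rewrite (fps_sum_reindex _ (set_bij_addn a)) -fps_sumMl; last first.
    exact/fps_growing_summable/growing_lhs.
  apply: eq_fps_sum => c _; rewrite /= fps_sum_level ?leq_addr // -addnS.
  rewrite prod_size_weight // invrM ?qpoch_unit //.
  rewrite /C /x expr_div_n addKn exprVn.
  have -> : ((2 * a).-1 + 2 * (a + c) = (4 * a - 1) + 2 * c)%N by lia.
  by rewrite exprD -!exprM; ring.
rewrite (qpoch_sum_duality x1 Q1 a0).
(* The duality sums from 0, so the index of the target is [n + 1], and its exponent splits as
   [(4 * a - 1) + 4 * a * n]. *)
rewrite (fps_sum_reindex _ (set_bij_addn 1)) -fps_sumMl; last first.
  by apply: fps_growing_summable; apply: (@growing_rhs _ x Q Q1 a 1).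
apply: eq_fps_sum => n _; rewrite /= add1n invrM ?qpoch_unit //.
have -> : (4 * a * n.+1 - 1 = (4 * a - 1) + 4 * (a * n))%N by lia.
by rewrite /C exprD -exprM -/Q -/x; ring.
Qed.

Lemma rhs_summable : fps_summable
  [set mn : nat * nat | (1 <= mn.1)%N /\ (1 <= mn.2)%N]
  (fun mn => q ^+ (4 * mn.1 * mn.2 - 1)%N
      / (qpoch (z ^+ 2 * q ^+ 2) (q ^+ 4) mn.1
         * qpoch (q ^+ 2 / z ^+ 2) (q ^+ 4) mn.2)).
Proof.
move=> k; apply: sub_finite_set (finite_setX (finite_II k.+2) (finite_II k.+2)).
move=> [m n] [/= [m0 n0] mnk].
(* The term has order at least [4 * m * n - 1]; with [m] and [n] positive this bounds both
   indices. *)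
suff : (4 * m * n - 1 <= k)%N by split=> /=; nia.
rewrite leqNgt; apply: contraNN mnk => kmn; apply/eqP.
by apply: (fps_ordMr _ (@fps_ord_qX (4 * m * n - 1))).
Qed.

End GeneratingFunction.

Theorem theorem1p3 :
  let lhs (p : intpart) : fps laurent := z ^ (srank p) * q ^+ weight p in
  let rhs (m n : nat) : fps laurent :=
    q ^+ (4 * m * n - 1)%N
      / (qpoch (z ^+ 2 * q ^+ 2) (q ^+ 4) m
         * qpoch (q ^+ 2 / z ^+ 2) (q ^+ 4) n) in
  [/\ fps_summable OEbar lhs,
      fps_summable [set mn : nat * nat | (1 <= mn.1)%N /\ (1 <= mn.2)%N]
        (fun mn => rhs mn.1 mn.2) &
      fps_sum OEbar lhs =
        fps_sum [set m : nat | (1 <= m)%N] (fun m =>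
          fps_sum [set n : nat | (1 <= n)%N] (fun n => rhs m n))].
Proof.
split; [exact: lhs_summable | exact: rhs_summable | ].
(* The outer index [m] is the odd level, and the inner sums agree for each [m] separately. *)
rewrite (@fps_sum_fibers _ _ _ _ [set m | (1 <= m)%N] odd_level); first last.
- by move=> p /odd_level_gt0.
- exact: lhs_summable.
by apply: eq_fps_sum => m /= m0; apply: fps_sum_odd_level.
Qed.
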